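(* Let $n$ be a non-negative integer and let $X$ be a strongly locally homogeneous continuum of covering dimension $\dim X=n$. Then $X$ is a $V^n$-continuum in the sense of Alexandroff. That is, for every two closed disjoint subsets $P$ and $Q$ of $X$, both having nonempty interiors, there exists an open cover $\omega$ of $X$ such that no partition $C\subset X$ between $P$ and $Q$ admits an $\omega$-map into a space $Y$ with $\dim Y\le n-2$.
   Context: A space means a locally compact separable metric space; maps are continuous. A continuum is a compact connected space. $\dim$ denotes covering dimension (with $\dim\varnothing=-1$). A space $X$ is strongly locally homogeneous if every point $x\in X$ has a basis of open neighborhoods $U$ such that for every $y,z\in U$ there is a homeomorphism $h:X\to X$ with $h(y)=z$ and $h$ equal to the identity on $X\setminus U$. A partition in $X$ between disjoint sets $P,Q\subset X$ is a closed set $C\subset X$ such that $X\setminus C=U\cup V$ with $U,V$ disjoint open subsets of $X$, $P\subset U$, $Q\subset V$. If $\omega$ is an open cover of $X$ and $C\subset X$, let $\omega|C=\{W\cap C: W\in\omega\}$. An $\omega$-map on $C$ into $Y$ is a continuous map $f:C\to Y$ such that for some open cover $\gamma$ of $Y$ the cover $f^{-1}(\gamma)$ refines $\omega|C$. *)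

(* Defs.v *)
From mathcomp Require Import all_boot all_order all_algebra.
From mathcomp Require Import all_classical reals topology.

Set Implicit Arguments.
Unset Strict Implicit.
Unset Printing Implicit Defensive.

Import Order.TTheory GRing.Theory Num.Theory.

Local Open Scope classical_set_scope.
Local Open Scope card_scope.
Local Open Scope ring_scope.

Section general_topology.
Context {T : topologicalType}.

Definition separable := exists2 D : set T, countable D & dense D.

Definition open_cover (F : set (set T)) :=
  F `<=` open /\ \bigcup_(A in F) A = [set: T].

Definition refines (F G : set (set T)) :=
  forall A, F A -> exists2 B, G B & A `<=` B.

(* In the usual terminology this says that the order of [F] is at most [m - 1]. *)
Definition multiplicity_le (F : set (set T)) (m : nat) :=
  forall x, [set A | F A /\ A x] #<= `I_m.

Definition homeomorphism (h : T -> T) :=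
  continuous h /\ exists g, [/\ continuous g, cancel h g & cancel g h].

Definition partition_between (P Q C : set T) :=
  closed C /\
  exists U V : set T, [/\ open U, open V, U `&` V = set0, ~` C = U `|` V &
                          P `<=` U /\ Q `<=` V].

(* The trace of a cover on [C], as a family of subsets of the subspace [C],
   i.e., of the type [set_type C] with its subtype topology. *)
Definition trace (omega : set (set T)) (C : set T) : set (set C) :=
  [set set_val @^-1` W | W in omega].

End general_topology.

Arguments separable : clear implicits.
Arguments trace {T} omega C _.

(* The integer [k] may be negative: [dim_le T (-1)] holds iff [T] is empty,
   and [dim_le T k] is false for [k < -1]. *)
Definition dim_le (T : topologicalType) (k : int) :=
  -1 <= k /\
  forall F : set (set T), finite_set F -> open_cover F ->
    exists G : set (set T),
      [/\ finite_set G, open_cover G, refines G F &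
          multiplicity_le G (absz (k + 1))].

Definition dim_eq (T : topologicalType) (k : int) :=
  dim_le T k /\ ~ dim_le T (k - 1).

Definition strongly_locally_homogeneous (T : topologicalType) :=
  forall (x : T) (O : set T), nbhs x O ->
    exists U : set T, [/\ open U, U x, U `<=` O &
      forall y z, U y -> U z ->
        exists h : T -> T, [/\ homeomorphism h, h y = z &
                               forall t, ~ U t -> h t = t]].

Definition is_continuum (T : topologicalType) :=
  compact [set: T] /\ connected [set: T].

(* The map is defined on the subtype [C] rather than on the ambient space:
   [C] and [Y] may both be empty, and then the empty map has to be allowed. *)
Definition omega_map (T Y : topologicalType) (omega : set (set T)) (C : set T)
    (f : C -> Y) :=
  continuous f /\
  exists2 gamma : set (set Y), open_cover gamma &
    refines [set f @^-1` G | G in gamma] (trace omega C).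

(* Metrizability is carried by the type. *)
Definition is_space (R : realType) (T : metricType R) :=
  locally_compact [set: T] /\ separable T.

Definition V_continuum (R : realType) (n : nat) (X : metricType R) :=
  forall P Q : set X,
    closed P -> closed Q -> P `&` Q = set0 ->
    interior P !=set0 -> interior Q !=set0 ->
    exists2 omega : set (set X), open_cover omega &
      forall C : set X, partition_between P Q C ->
        ~ exists (Y : metricType R) (f : C -> Y),
            [/\ is_space Y, dim_le Y (n%:Z - 2) & omega_map omega f].

(* Main.v *)
Require Import Defs.
From mathcomp Require Import all_boot all_order all_algebra.
From mathcomp Require Import all_classical reals topology.

(** Call a set C thin for a cover w when it is covered by finitely many open
    sets refining w, at most n - 1 of which share a point.  A closed C with a
    w-map into a space of dimension at most n - 2 is thin.  If the theorem fails
    for P and Q, then P and Q are separated by partitions thin for arbitrarily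
    fine covers.  Consider the pairs (p, q) of points that have neighbourhoods
    separated in this way.  For fixed p the set N(p) of such q is open, and
    strong local homogeneity makes it closed in X \ {p}: a homeomorphism fixing
    p moves nearby points to a given limit point.  Unless N(p) is empty it is
    all of X \ {p}: if E = N(p) and M, its complement in X \ {p}, are nonempty,
    then {p} is a thin partition between E and M (when n >= 2), so N(r) contains
    E, hence p, for r in M.  Thus one bad pair P, Q makes all pairs of distinct
    points thinly separated.  By compactness a point is thinly separated from
    any closed set not containing it, and these partitions cut X into a thin
    set and disjoint small open sets, so that dim X <= n - 1. *)

Set Implicit Arguments.
Unset Strict Implicit.
Unset Printing Implicit Defensive.

Import Order.TTheory GRing.Theory Num.Theory.

Local Open Scope classical_set_scope.
Local Open Scope card_scope.

(** * Compactness and counting *)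

(** The sets whose removal from [K] leaves a set satisfying [phi] form a filter, proper unless
    [phi K]. A cluster point of it in [K] has a neighbourhood satisfying [phi], whose complement is
    then in the filter: a contradiction. *)
Lemma compact_induction (T : topologicalType) (K : set T)
    (phi : set T -> Prop) :
  phi set0 ->
  (forall A B, A `<=` B -> phi B -> phi A) ->
  (forall A B, phi A -> phi B -> phi (A `|` B)) ->
  compact K ->
  (forall x, K x -> exists2 V, nbhs x V & phi V) ->
  phi K.
Proof.
move=> phi0 phiS phiU Kc Kloc; apply: contrapT => nphiK.
pose F : set_system T := [set A | phi (K `\` A)].
have FF : ProperFilter F.
  split=> [|]; first by rewrite /F /= setD0.
  split=> [|A B FA FB|A B AB FA].
  - by rewrite /F /= setDT.
  - by rewrite /F /= setDIr; exact: phiU.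
  - by apply: phiS FA => x [Kx nBx]; split=> // /AB.
have FK : F K by rewrite /F /= setDv.
have [x [Kx Fx]] := Kc F FF FK.
have [V xV phiV] := Kloc x Kx.
have FV : F (~` V) by apply: phiS phiV => y [_] /contrapT.
by have [y []] := Fx _ _ FV xV.
Qed.

Lemma finite_set_argmin d (T : Type) (R : orderType d) (f : T -> R)
    (S : set T) :
  finite_set S -> S !=set0 ->
  exists2 a, S a & forall b, S b -> (f a <= f b)%O.
Proof.
elim/Pchoice: T => T in f S *.
move=> /finite_seqP[s ->] {S} [x0 x0s].
elim: s x0 x0s => // x s IH _ _.
have inP (b : T) : [set` x :: s] b -> b = x \/ b \in s.
  by rewrite /mkset in_cons => /predU1P.
have xin : [set` x :: s] x by rewrite /mkset mem_head.
have [[y ys]|s0] := pselect (exists y, y \in s); last first.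
  by exists x => // b /inP[->//|bs]; case: s0; exists b.
have [a as_ amin] := IH y ys.
have [le|lt] := leP (f x) (f a).
  by exists x => // b /inP[->//|/amin]; apply: le_trans.
exists a; first by rewrite /mkset in_cons as_ orbT.
by move=> b /inP[->|/amin//]; apply: ltW.
Qed.

Lemma card_le_setU_II (T : Type) (A B : set T) (m k : nat) :
  A #<= `I_m -> B #<= `I_k -> A `|` B #<= `I_(m + k).
Proof.
move=> /pcard_leP/injfunPex[f fS fI] /pcard_leP/injfunPex[g gS gI].
apply/pcard_leP/injfunPex.
exists (fun x => if x \in A then f x else m + g x)%N.
  move=> x ABx /=; case: ifPn => [/set_mem Ax|/negP nAx].
    by apply: leq_trans (leq_addr _ _); apply: fS.
  rewrite ltn_add2l; apply: gS.
  by case: ABx => // /mem_set.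
have fA x : A x -> (f x < m)%N by apply: fS.
have BnA x : (A `|` B) x -> x \notin A -> x \in B.
  by case=> [/mem_set ->//|/mem_set].
move=> x y /set_mem ABx /set_mem ABy; case: ifPn => Ax; case: ifPn => Ay.
- exact: fI.
- by move=> e; have := fA _ (set_mem Ax); rewrite e ltnNge leq_addr.
- by move=> e; have := fA _ (set_mem Ay); rewrite -e ltnNge leq_addr.
- by move=> /addnI; apply: gI; apply: BnA.
Qed.

(** Serves to bound a new family at [y] by an old one at [x]: the sets to be counted lie in the
    image under [g] of the members of [F] at [x]. *)
Lemma multiplicity_transfer (T U : topologicalType) (F : set (set T))
    (G : set (set U)) m (x : T) (y : U) (g : set T -> set U) :
  multiplicity_le F m ->
  (forall B, G B -> B y -> exists A, [/\ F A, A x & g A = B]) ->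
  [set B | G B /\ B y] #<= `I_m.
Proof.
move=> Fm GF; apply: card_le_trans (Fm x).
apply: card_le_trans (card_image_le g _); apply: subset_card_le.
by move=> B [GB By]; have [A [FA Ax <-]] := GF B GB By; exists A.
Qed.

(** * Thin sets and their unions *)

(** The number [m] counts the members that may share a point, so it corresponds to dimension m -
    1. *)
Definition thin (T : topologicalType) m (w : set (set T)) (C : set T) :=
  exists F : set (set T), [/\ finite_set F, F `<=` open, refines F w,
    multiplicity_le F m & C `<=` \bigcup_(A in F) A].

Lemma open_cover_setT (T : topologicalType) : open_cover [set [set: T]].
Proof. by split; [move=> _ ->; exact: openT|rewrite bigcup_set1]. Qed.

Lemma open_cover_ex (T : topologicalType) (w : set (set T)) x :
  open_cover w -> exists2 W, w W & W x.
Proof. by move=> [_ /seteqP[_ /(_ x I)]] [W]; exists W. Qed.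

Lemma thin_subset (T : topologicalType) m (w : set (set T)) C D :
  C `<=` D -> thin m w D -> thin m w C.
Proof.
by move=> CD [F [? ? ? ? DF]]; exists F; split=> //; exact: subset_trans DF.
Qed.

Lemma thin_set0 (T : topologicalType) m (w : set (set T)) : thin m w set0.
Proof.
exists set0; split=> // x.
by rewrite (_ : mkset _ = set0) // -subset0 => A [].
Qed.

Lemma thin0_eq0 (T : topologicalType) (w : set (set T)) C :
  thin 0 w C -> C = set0.
Proof.
move=> [F [_ _ _ F0 CF]]; rewrite -subset0 => x /CF[A FA Ax].
have := F0 x; rewrite II0 => /card_le0P F0x.
by have : [set A | F A /\ A x] A by []; rewrite F0x.
Qed.

Lemma thin_set1 (T : topologicalType) m (w : set (set T)) x :
  open_cover w -> thin m.+1 w [set x].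
Proof.
move=> wc; have [W wW Wx] := open_cover_ex x wc.
exists [set W]; split=> [|A ->|A ->|y|y ->].
- exact: finite_set1.
- by case: wc => wo _; apply: wo.
- by exists W.
- apply: (@card_le_trans _ _ _ ((fun _ : nat => W) @` `I_1)).
    by apply: subset_card_le => A [-> _]; exists 0%N.
  by apply: card_le_trans (card_image_le _ _) _; rewrite card_le_II.
- by exists W.
Qed.

(* The second cover is amalgamated along the first one near C1, so that a point
   there only sees elements of the first cover; this requires the second cover
   to be finer than the first one, whence the dependence of w2 on C1. *)
Lemma thin_setU (T : topologicalType) m (w : set (set T)) (C1 : set T) :
  normal_space T -> open_cover w -> closed C1 -> thin m w C1 ->
  exists2 w2, open_cover w2 &
    forall C2, thin m w2 C2 -> thin m w (C1 `|` C2).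
Proof.
move=> nT wc cC1 [F1 [F1fin F1o F1w F1m C1F1]].
have : set_nbhs C1 (\bigcup_(A in F1) A).
  move=> x C1x; apply: open_nbhs_nbhs; split; last exact: C1F1.
  exact: bigcup_open.
move=> /(nT _ cC1)[N C1N clN]; pose O := N°.
have Oo : open O by exact: open_interior.
have C1O : C1 `<=` O by move=> x /C1N.
have {clN} clO : closure O `<=` \bigcup_(A in F1) A.
  by apply: subset_trans clN; apply: closureS; apply: interior_subset.
pose near1 (A : set T) := exists2 B, F1 B & A `<=` B.
exists [set A | [/\ open A, exists2 W, w W & A `<=` W &
                    A `&` O = set0 \/ near1 A]].
  split; first by move=> A [].
  apply/seteqP; split=> // x _; have [W wW Wx] := open_cover_ex x wc.
  have [xO|xO] := pselect (closure O x).
    have [B F1B Bx] := clO _ xO.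
    exists (W `&` B); last by split.
    split; [|by exists W|by right; exists B].
    by apply: openI; [case: wc => wo _; apply: wo|apply: F1o].
  exists (W `&` ~` closure O); last by split.
  split; [|by exists W|left].
    apply: openI; first by case: wc => wo _; apply: wo.
    exact/closed_openC/closed_closure.
  by rewrite -subset0 => y [[_ nOy] /subset_closure].
move=> C2 [F2 [F2fin F2o F2w F2m C2F2]].
have [r rP] : exists r : set T -> set T, forall A, F2 A -> A `&` O !=set0 ->
    F1 (r A) /\ A `<=` r A.
  have /choice[r rP] : forall A, exists B, F2 A -> A `&` O !=set0 ->
      F1 B /\ A `<=` B.
    move=> A; have [F2A|] := pselect (F2 A); last by exists set0.
    have [AO|] := pselect (A `&` O !=set0); last by exists set0.
    have [A' [_ _ A'O] AA'] := F2w _ F2A.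
    case: A'O => [A'O|[B F1B A'B]]; last first.
      by exists B => _ _; split=> //; apply: subset_trans A'B.
    case: AO => y [Ay Oy]; have : (A' `&` O) y; last by rewrite A'O.
    by split=> //; exact: AA'.
  by exists r.
pose g B := (B `&` O) `|`
  \bigcup_(A in [set A | [/\ F2 A, A `&` O !=set0 & r A = B]]) A.
have gB B : F1 B -> g B `<=` B.
  move=> F1B y [[]//|[A [F2A AO <-] Ay]].
  by have [_] := rP A F2A AO; apply.
exists (g @` F1 `|` [set A | F2 A /\ A `&` O = set0]); split.
- rewrite finite_setU; split; first exact: finite_image.
  by apply: sub_finite_set F2fin => A [].
- move=> A [[B F1B <-]|[F2A _]]; last exact: F2o.
  apply: openU; first by apply: openI => //; exact: F1o.
  by apply: bigcup_open => A' [F2A' _ _]; exact: F2o.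
- move=> A [[B F1B <-]|[F2A _]].
    by have [W wW BW] := F1w B F1B; exists W => //;
      apply: subset_trans BW; apply: gB.
  have [A' [_ [W wW A'W] _] AA'] := F2w _ F2A.
  by exists W => //; exact: subset_trans A'W.
(* On [O] only sets [g B] occur, and [g B] lies in [B], so [F1] gives the bound; off [O] each set at
   [x] comes from a member of [F2] at [x]. Hence the two multiplicities do not add up. *)
- move=> x; have [Ox|Ox] := pselect (O x).
    apply: (multiplicity_transfer (x := x) (g := g) F1m).
    move=> A [[B F1B <-]|[_ AO0]] Ax; last first.
      by have : (set0 : set T) x by rewrite -AO0.
    by exists B; split=> //; apply: gB.
  pose h A := if A `&` O == set0 then A else g (r A).
  apply: (multiplicity_transfer (x := x) (g := h) F2m).
  move=> A' [[B F1B <-]|[F2A AO0]] A'x; last first.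
    by exists A'; split=> //; rewrite /h AO0 eqxx.
  case: A'x => [[_ /Ox]//|[A [F2A AO rA] Ax]]; exists A; split=> //.
  by rewrite /h ifN ?rA//; exact/set0P.
- move=> x [C1x|C2x].
    have [B F1B Bx] := C1F1 _ C1x; exists (g B); first by left; exists B.
    by left; split=> //; apply: C1O.
  have [A F2A Ax] := C2F2 _ C2x.
  have [AO|/set0P AO] := eqVneq (A `&` O) set0; first by exists A => //; right.
  have [F1r _] := rP A F2A AO.
  exists (g (r A)); first by left; exists (r A).
  by right; exists A.
Qed.

(** * Thin separation of sets *)

Lemma partition_betweenC (T : topologicalType) (P Q C : set T) :
  partition_between P Q C -> partition_between Q P C.
Proof.
move=> [cC [U [V [oU oV UV CUV [PU QV]]]]]; split=> //.
by exists V, U; split=> //; rewrite 1?setIC 1?setUC.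
Qed.

Definition thin_separable (T : topologicalType) m (P Q : set T) :=
  forall w : set (set T), open_cover w ->
    exists2 C, thin m w C & partition_between P Q C.

Lemma thin_separableC (T : topologicalType) m (P Q : set T) :
  thin_separable m P Q -> thin_separable m Q P.
Proof.
by move=> PQ w /PQ[C Cw PCQ]; exists C => //; exact: partition_betweenC.
Qed.

Lemma thin_separableS (T : topologicalType) m (P P' Q Q' : set T) :
  P' `<=` P -> Q' `<=` Q -> thin_separable m P Q -> thin_separable m P' Q'.
Proof.
move=> P'P Q'Q PQ w /PQ[C Cw [cC [U [V [oU oV UV CUV [PU QV]]]]]].
exists C => //; split=> //; exists U, V; split=> //.
by split; [exact: subset_trans PU|exact: subset_trans QV].
Qed.

Lemma thin_separable_set0 (T : topologicalType) m (P : set T) :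
  thin_separable m P set0.
Proof.
move=> w wc; exists set0; first exact: thin_set0.
split; first exact: closed0.
by exists setT, set0; split; [exact: openT|exact: open0|rewrite setI0
  |rewrite setC0 setU0|split].
Qed.

Lemma thin_separableU (T : topologicalType) m (P Q1 Q2 : set T) :
  normal_space T -> thin_separable m P Q1 -> thin_separable m P Q2 ->
  thin_separable m P (Q1 `|` Q2).
Proof.
move=> nT PQ1 PQ2 w wc.
have [C1 C1w [cC1 [U1 [V1 [oU1 oV1 UV1 C1E [PU1 QV1]]]]]] := PQ1 w wc.
have [w2 w2c w2P] := thin_setU nT wc cC1 C1w.
have [C2 C2w [cC2 [U2 [V2 [oU2 oV2 UV2 C2E [PU2 QV2]]]]]] := PQ2 w2 w2c.
(* A point outside [C1] and [C2] lies in [U1] or [V1] and in [U2] or [V2], hence in the open set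
   removed here; so the new partition is contained in the union of [C1] and [C2]. *)
exists (~` ((U1 `&` U2) `|` (V1 `|` V2))).
  apply: thin_subset (w2P _ C2w) => x; apply: contra_notP.
  move=> /not_orP[]; rewrite -[~ C1 x]/((~` C1) x) -[~ C2 x]/((~` C2) x).
  rewrite C1E C2E => -[U1x|V1x] [U2x|V2x]; try by right; (left + right).
  by left.
have oUV : open ((U1 `&` U2) `|` (V1 `|` V2)).
  by apply: openU; [exact: openI|exact: openU].
split; first exact: open_closedC.
exists (U1 `&` U2), (V1 `|` V2); split.
- exact: openI.
- exact: openU.
- rewrite -subset0 => x [[U1x U2x] [V1x|V2x]].
    by rewrite -UV1.
  by rewrite -UV2.
- by rewrite setCK.
- split; first by move=> x Px; split; [exact: PU1|exact: PU2].
  exact: setUSS.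
Qed.

Lemma thin_separable_preimage (T : topologicalType) m (g : T -> T)
    (P Q : set T) :
  homeomorphism g -> thin_separable m P Q ->
  thin_separable m (g @^-1` P) (g @^-1` Q).
Proof.
move=> [gc [h [hc gK hK]]] PQ w wc.
have preo (f : T -> T) : continuous f -> forall A, open A -> open (f @^-1` A).
  by move=> fc A oA; apply: open_comp => // x _; exact: fc.
(* The cover is transported by the inverse [h], so that pulling back along [g] gives sets refining
   [w]. *)
have [|C [F [Ffin Fo Fw Fm CF]]] := PQ [set h @^-1` W | W in w].
  split; first by move=> _ [W wW <-]; apply: preo => //; case: wc => + _; apply.
  apply/seteqP; split=> // x _; have [W wW Wx] := open_cover_ex (h x) wc.
  by exists (h @^-1` W) => //; exists W.
move=> [cC [U [V [oU oV UV CE [PU QV]]]]]; exists (g @^-1` C).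
  exists [set g @^-1` A | A in F]; split.
  - exact: finite_image.
  - by move=> _ [A FA <-]; apply: preo => //; exact: Fo.
  - move=> _ [A FA <-]; have [_ [W wW <-] AW] := Fw _ FA.
    by exists W => // x /AW /=; rewrite gK.
  - move=> x; apply: (multiplicity_transfer (x := g x) (g := preimage g) Fm).
    by move=> _ [A FA <-] Ax; exists A.
  - by move=> x /CF[A FA Ax]; exists (g @^-1` A) => //; exists A.
split; first by rewrite -[g @^-1` C]setCK; apply/open_closedC;
  rewrite preimage_setC; apply: preo => //; exact: closed_openC.
exists (g @^-1` U), (g @^-1` V); split; [exact: preo|exact: preo|..].
- by rewrite -preimage_setI UV preimage_set0.
- by rewrite preimage_setC CE preimage_setU.
- by split=> x; [apply: PU|apply: QV].
Qed.

(** * Thin separation of points *)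

Definition locally_thin_separable (T : topologicalType) m (p q : T) :=
  exists P Q, [/\ nbhs p P, nbhs q Q & thin_separable m P Q].

Section point_separation.
Variables (T : topologicalType) (m : nat).
Local Notation sep := (@locally_thin_separable T m).

Lemma locally_thin_separableC p q : sep p q -> sep q p.
Proof.
by move=> [P [Q [Pp Qq PQ]]]; exists Q, P; split=> //; exact: thin_separableC.
Qed.

Lemma locally_thin_separable_homeomorphism h p q :
  homeomorphism h -> sep p q -> sep (h p) (h q).
Proof.
move=> [hc [g [gc hK gK]]] [P [Q [Pp Qq PQ]]].
exists (g @^-1` P), (g @^-1` Q); split.
- by apply: gc; rewrite hK.
- by apply: gc; rewrite hK.
- by apply: thin_separable_preimage PQ; split=> //; exists h.
Qed.

Lemma locally_thin_separable_irr p : ~ sep p p.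
Proof.
move=> [P [Q [Pp Qp PQ]]]; have [|C _] := PQ [set setT].
  split; first by move=> _ ->; exact: openT.
  by rewrite bigcup_set1.
move=> [cC [U [V [_ _ UV _ [PU QV]]]]].
have : (set0 : set T) p; last by [].
by rewrite -UV; split; [apply: PU|apply: QV]; exact: nbhs_singleton.
Qed.

Lemma open_locally_thin_separable p : open [set q | sep p q].
Proof.
rewrite openE => q [P [Q [Pp Qq PQ]]]; rewrite /interior.
move: Qq => /nbhs_interior; apply: filterS => r Qr.
by exists P, Q.
Qed.

Lemma closed_locally_thin_separable p q : accessible_space T ->
  strongly_locally_homogeneous T -> q <> p ->
  closure [set q | sep p q] q -> sep p q.
Proof.
move=> T1 slh qp clq.
have : nbhs q (~` [set p]).
  apply: open_nbhs_nbhs; split=> //; apply: closed_openC.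
  exact: accessible_closed_set1.
move=> /slh[U [oU Uq Up Utrans]].
have [|r [pr Ur]] := clq U; first exact: open_nbhs_nbhs.
have [h [hh hr hfix]] := Utrans r q Ur Uq.
rewrite -hr -(hfix p); last by move=> /Up; apply.
exact: locally_thin_separable_homeomorphism.
Qed.

End point_separation.

Lemma locally_thin_separable_allr (T : topologicalType) m (p q : T) :
  accessible_space T -> strongly_locally_homogeneous T ->
  connected [set: T] -> locally_thin_separable m.+1 p q ->
  forall r, r <> p -> locally_thin_separable m.+1 p r.
Proof.
move=> T1 slh Tc pq r rp; apply: contrapT => npr.
pose E := [set s | locally_thin_separable m.+1 p s].
have oE : open E by exact: open_locally_thin_separable.
have nEp : ~ E p by exact: locally_thin_separable_irr.
have clE : closure E `<=` E `|` [set p].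
  move=> s Es; have [->|/eqP sp] := eqVneq s p; first by right.
  by left; apply: closed_locally_thin_separable.
(* Otherwise [E] is closed as well as open, and connectedness makes it the whole space, against
   [nEp]. *)
have pE : closure E p.
  apply: contrapT => npE; apply: nEp.
  have -> // : E = setT.
  apply: Tc; first by exists q.
    by exists E; rewrite ?setTI.
  exists E; rewrite ?setTI// => s Es; have [//|sp] := clE s Es.
  by rewrite sp in Es.
pose M := ~` (E `|` [set p]).
have EpE : E `|` [set p] = closure E.
  by apply/seteqP; split=> // s [/subset_closure|->].
have oM : open M by rewrite /M EpE; exact/closed_openC/closed_closure.
have Mr : M r by case.
(* A single point is thin because at least one member may contain it; this is where [m.+1]
   matters. *)
have EM : thin_separable m.+1 E M.
  move=> w wc; exists [set p]; first exact: thin_set1.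
  split; first exact: accessible_closed_set1.
  exists E, M; split=> //; last by split.
    by rewrite -subset0 => s [Es]; apply; left.
  apply/seteqP; split=> [s /= sp|s [Es|nEs] sp].
  - by have [Es|nEs] := pselect (E s); [left|right; case].
  - by apply: nEp; rewrite -sp.
  - by apply: nEs; right.
(* The point [p] is a limit of [E], all of whose points are separated from [r]. *)
apply: npr; apply: locally_thin_separableC.
apply: closed_locally_thin_separable => //; first exact: nesym.
have Er : E `<=` [set s | locally_thin_separable m.+1 r s].
  move=> s Es; apply: locally_thin_separableC; exists E, M.
  by split=> //; apply: open_nbhs_nbhs.
by apply: closureS pE.
Qed.

(** * From thin separation to dimension *)

(** Finitely many neighbourhoods of points of [Q] cover [Q], and the intersection of the matching
    neighbourhoods of [p] is separated from their union. *)
Lemma thin_separable_point_closed (T : topologicalType) m (p : T) (Q : set T) :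
  normal_space T -> compact [set: T] ->
  (forall q, q <> p -> locally_thin_separable m p q) ->
  closed Q -> ~ Q p -> exists2 P, nbhs p P & thin_separable m P Q.
Proof.
move=> nT Tc psep cQ Qp.
apply: (@compact_induction T Q
  (fun Q' => exists2 P, nbhs p P & thin_separable m P Q')).
- by exists setT; [exact: filterT|exact: thin_separable_set0].
- by move=> A B AB [P Pp PB]; exists P => //; exact: thin_separableS PB.
- move=> A B [P1 P1p P1A] [P2 P2p P2B].
  exists (P1 `&` P2); first exact: filterI.
  apply: thin_separableU => //.
    by apply: thin_separableS P1A => // x [].
  by apply: thin_separableS P2B => // x [].
- exact: subclosed_compact Tc _.
- move=> q Qq; have [|P [V [Pp Vq PV]]] := psep q.
    by move=> qp; rewrite qp in Qq.
  by exists V => //; exists P.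
Qed.

(* The set X is cut into a thin set C and disjoint small open sets; adjoining
   the latter to a thin cover of C raises the multiplicity only by one. *)
Lemma refinement_of_thin_separable (T : topologicalType) m
    (F : set (set T)) :
  normal_space T -> compact [set: T] ->
  (forall (p : T) Q, closed Q -> ~ Q p ->
    exists2 P, nbhs p P & thin_separable m P Q) ->
  open_cover F ->
  exists G, [/\ finite_set G, open_cover G, refines G F &
                multiplicity_le G m.+1].
Proof.
move=> nT Tc sepT Fc.
(* Quantifying over [w] lets a second piece be thin for the cover dictated by the first. Closedness
   of [C] together with the sets of [D] keeps the second family open once the first piece is removed
   from it. *)
pose phi (K : set T) := forall w, open_cover w -> exists D : set (set T),
  [/\ finite_set D, D `<=` open, refines D F &
      forall A B x, D A -> D B -> A x -> B x -> A = B] /\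
  exists C : set T, [/\ thin m w C, closed C,
    closed (C `|` \bigcup_(A in D) A) & K `<=` C `|` \bigcup_(A in D) A].
have : phi setT.
  apply: compact_induction => //.
  - move=> w wc; exists set0; split; first by split=> // A [].
    exists set0; rewrite bigcup_set0 setU0.
    by split; [exact: thin_set0|exact: closed0|exact: closed0|].
  - move=> A B AB phiB w /phiB[D [DP [C [Cw cC cCD BCD]]]].
    by exists D; split=> //; exists C; split=> //; exact: subset_trans BCD.
  - move=> K1 K2 phi1 phi2 w wc.
    have [D1 [[D1f D1o D1F D1t] [C1 [C1w cC1 cCD1 K1CD]]]] := phi1 w wc.
    have [w2 w2c w2P] := thin_setU nT wc cC1 C1w.
    have [D2 [[D2f D2o D2F D2t] [C2 [C2w cC2 cCD2 K2CD]]]] := phi2 w2 w2c.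
    pose S := C1 `|` \bigcup_(A in D1) A.
    (* Removing [S] keeps the members disjoint and loses only points of [S], which the first piece
       covers already. *)
    pose D := D1 `|` [set A `\` S | A in D2].
    have DE : (C1 `|` C2) `|` \bigcup_(A in D) A =
        S `|` (C2 `|` \bigcup_(A in D2) A).
      rewrite bigcup_setU; apply/seteqP; split=> x.
        move=> [[C1x|C2x]|[D1x|[_ [A D2A <-] [Ax _]]]].
        - by left; left.
        - by right; left.
        - by left; right.
        - by right; right; exists A.
      move=> [[C1x|D1x]|[C2x|[A D2A Ax]]].
      - by left; left.
      - by right; left.
      - by left; right.
      have [[C1x|D1x]|Sx] := pselect (S x).
      - by left; left.
      - by right; left.
      - by right; right; exists (A `\` S) => //; exists A.
    exists D; split.
      split.
      + by rewrite finite_setU; split=> //; exact: finite_image.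
      + move=> A [|[B D2B <-]]; first exact: D1o.
        by apply: openI; [exact: D2o|exact: closed_openC].
      + move=> A [|[B D2B <-]]; first exact: D1F.
        by have [W FW BW] := D2F _ D2B; exists W => // x [/BW].
      + move=> A B x [D1A|[A' D2A <-]] [D1B|[B' D2B <-]].
        * exact: D1t.
        * by move=> Ax [_ []]; right; exists A.
        * by move=> [_ +] Bx; case; right; exists B.
        * by move=> [Ax _] [Bx _]; rewrite (D2t A' B' x).
    exists (C1 `|` C2); rewrite DE; split.
    + exact: w2P.
    + exact: closedU.
    + exact: closedU.
    + exact: setUSS.
  - move=> x _; have [W FW Wx] := open_cover_ex x Fc.
    have oW : open W by case: Fc => Fo _; exact: Fo.
    have [||V Vx VW] := sepT x (~` W); [exact: open_closedC|by move/(_ Wx)|].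
    exists V => // w wc.
    have [C Cw [cC [U1 [U2 [oU1 oU2 U12 CE [VU WU]]]]]] := VW w wc.
    exists [set U1]; split.
      split=> [|A ->|A ->|A B y -> ->] //.
      exists W => // y U1y; apply: contrapT => /WU U2y.
      by have : (U1 `&` U2) y by []; rewrite U12.
    exists C; rewrite bigcup_set1; split=> //; last by move=> y /VU; right.
    have -> : C `|` U1 = ~` U2.
      rewrite -[C]setCK CE; apply/seteqP; split=> y.
        move=> [/not_orP[]//|U1y U2y].
        by have : (U1 `&` U2) y by []; rewrite U12.
      by move=> nU2; have [|nU1] := pselect (U1 y); [right|left; case].
    exact: open_closedC.
move=> /(_ F Fc)[D [[Df Do DF Dt] [C [[E [Ef Eo EF Em CE]] _ _ TCD]]]].
exists (E `|` D); split.
- by rewrite finite_setU.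
- split; first by move=> A [/Eo|/Do].
  rewrite bigcup_setU; apply/seteqP; split=> // x _.
  by have [/CE|] := TCD x I; [left|right].
- by move=> A [/EF|/DF].
- move=> x; apply: (@card_le_trans _ _ _
      ([set A | E A /\ A x] `|` [set A | D A /\ A x])).
    by apply: subset_card_le => A [[EA|DA] Ax]; [left; split|right; split].
  rewrite -addn1; apply: card_le_setU_II => //.
  have [[B [DB Bx]]|nB] := pselect (exists B, D B /\ B x); last first.
    rewrite (_ : mkset _ = set0)// -subset0 => A [DA Ax].
    by apply: nB; exists A.
  apply: (@card_le_trans _ _ _ ((fun _ : nat => B) @` `I_1)).
    by apply: subset_card_le => A [DA Ax]; exists 0%N => //; exact: (Dt B A x).
  by apply: card_le_trans (card_image_le _ _) _; rewrite card_le_II.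
Qed.

(** * From [omega_map] to thin sets *)

Lemma nbhs_set_type (T : topologicalType) (C : set T) (c : C) (U : set C) :
  nbhs c U -> exists2 W : set T, open W /\ W (set_val c) &
    forall d : C, W (set_val d) -> U d.
Proof. by move=> [_ [[W oW <-] Wc WU]]; exists W. Qed.

Lemma compact_set_type (T : topologicalType) (C : set T) :
  compact C -> compact [set: C].
Proof.
move=> Cc F FF _; pose G : set_system T := [set A | F (set_val @^-1` A)].
have FG : ProperFilter G by exact: fmap_proper_filter.
have GC : G C.
  rewrite /G /mkset; apply: filterS (@filterT _ F _) => c _.
  exact: set_valP.
have [x [Cx Gx]] := Cc G FG GC.
exists (exist _ x (mem_set Cx)); split=> // A U FA /nbhs_set_type[W [oW Wx] WU].
have : G (set_val @` A).
  by rewrite /G /mkset; apply: filterS FA => c Ac; exists c.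
move=> /Gx /(_ (open_nbhs_nbhs (conj oW Wx)))[_ [[c Ac <-] Wc]].
by exists c; split=> //; exact: WU.
Qed.

Lemma nbhs_ball_metric (R : realType) (X : metricType R) (c x : X) (r : R) :
  ball c r x -> nbhs x (ball c r).
Proof.
rewrite ballEmdist /= => cx; apply/nbhs_ballP.
exists (r - mdist c x)%R; first by rewrite /= subr_gt0.
move=> y; rewrite ballEmdist /= ltrBrDl.
by apply: le_lt_trans; exact: metric_triangle.
Qed.

(* Each preimage under f, open only in C, is swelled to an open subset of X:
   if x lies in several swellings, the witness of least radius lies in all of
   the preimages, so the multiplicity does not increase. *)
Lemma omega_map_thin (R : realType) (X Y : metricType R) m
    (w : set (set X)) (C : set X) (f : C -> Y) (k : int) :
  compact C -> open_cover w -> omega_map w f -> dim_le Y k ->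
  absz (k + 1)%R = m -> thin m w C.
Proof.
move=> Cc wc [fc [gam gamc gamw]] [_ dimY] km.
have C'c : compact [set: C] by exact: compact_set_type.
have preo A : open A -> open (f @^-1` A).
  by move=> oA; apply: open_comp => // x _; exact: fc.
(* Since [dim_le] speaks of finite covers, compactness of [C] first extracts finitely many members
   of [gam] covering the image. *)
have [gam' [gam'f gam'gam] gam'C] : exists2 g', finite_set g' /\ g' `<=` gam &
    forall c, [set: C] c -> exists2 B, g' B & B (f c).
  apply: (@compact_induction C setT (fun K => exists2 g',
    finite_set g' /\ g' `<=` gam &
    forall c, K c -> exists2 B, g' B & B (f c))) => //.
  - by exists set0 => //; split.
  - by move=> A B AB [g' ? Bg']; exists g' => // c /AB; exact: Bg'.
  - move=> A B [g1 [g1f g1s] Ag1] [g2 [g2f g2s] Bg2]; exists (g1 `|` g2).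
      by split; [rewrite finite_setU|move=> D [/g1s|/g2s]].
    move=> c [/Ag1|/Bg2] [D gD Dc]; exists D => //; by [left|right].
  - move=> c _; have [B gB Bc] := open_cover_ex (f c) gamc.
    exists (f @^-1` B).
      apply: open_nbhs_nbhs; split=> //; apply: preo.
      by case: gamc => + _; apply.
    exists [set B]; last by move=> d Bd; exists B.
    by split; [exact: finite_set1|move=> _ ->].
have cfC : closed (range f).
  apply: compact_closed; first exact: metric_hausdorff.
  by apply: continuous_compact => //; exact: continuous_subspaceT.
(* The image is closed; its complement completes [gam'] to a finite open cover of [Y]. *)
have [||G [Gf [Go GT] Gref Gm]] := dimY (gam' `|` [set ~` range f]).
- by rewrite finite_setU; split=> //; exact: finite_set1.
- split.
    move=> A [/gam'gam gA|->]; first by case: gamc => + _; apply.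
    exact: closed_openC.
  apply/seteqP; split=> // y _; have [[c _ <-]|yf] := pselect (range f y).
    by have [B g'B Bc] := gam'C c I; exists B => //; left.
  by exists (~` range f) => //; right.
rewrite km in Gm.
(* Members missing the image may refine only its complement and then have no associated member of
   [w], so they are dropped. *)
pose G' := [set A | G A /\ range f `&` A !=set0].
have /choice[W WP] : forall A, exists W, G' A ->
    w W /\ forall c, A (f c) -> W (set_val c).
  move=> A.
  have [[GA [y [[c _ cy] Ay]]]|] := pselect (G' A); last by exists set0.
  have [B + AB] := Gref A GA; case=> [g'B|BE]; last first.
    by have := AB y Ay; rewrite BE; case; exists c.
  have [|_ [W wW <-] BW] := gamw (f @^-1` B).
    by exists B => //; exact: gam'gam.
  by exists W => _; split=> // d Ad; apply: BW; exact: AB.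
(* The radius is doubled because a centre within r' of [x], with r' at most r, is within 2r of any
   centre that is within r of [x]. *)
pose wit A x (p : C * R) := [/\ 0 < p.2, ball (set_val p.1) p.2 x,
  A (f p.1) & forall d,
    ball (set_val p.1) (p.2 + p.2) (set_val d) -> A (f d)]%R.
pose e A := [set x | exists p, wit A x p] `&` W A.
have eo A : G' A -> open (e A).
  move=> G'A; apply: openI; last first.
    by have [wW _] := WP A G'A; case: wc => + _; apply.
  rewrite openE => x [[c r] /= [r0 cx Ac cA]]; rewrite /interior.
  have : nbhs x (ball (set_val c) r) by exact: nbhs_ball_metric.
  by apply: filterS => y cy; exists (c, r).
exists (e @` G'); split.
- by apply: finite_image; apply: sub_finite_set Gf => A [].
- by move=> _ [A G'A <-]; exact: eo.
- move=> _ [A G'A <-]; have [wW _] := WP A G'A; exists (W A) => //.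
  by move=> x [].
- move=> x.
  pose S := [set A | G' A /\ e A x].
  have [S0|/set0P S0] := eqVneq S set0.
    rewrite (_ : mkset _ = set0)// -subset0 => _ [[A G'A <-] Ax].
    by have : S A by []; rewrite S0.
  have /choice[p pP] : forall A, exists p, e A x -> wit A x p.
    case: (S0) => B [_ [[q _] _]] A.
    have [[[p Ap] _]|] := pselect (e A x); first by exists p.
    by exists q.
  have Sf : finite_set S by apply: sub_finite_set Gf => A [[]].
  have [A0 SA0 A0min] := finite_set_argmin (fun A => (p A).2) Sf S0.
  apply: (multiplicity_transfer (x := f (p A0).1) (g := e) Gm).
  move=> _ [A G'A <-] Ax; exists A; split=> //; first by case: G'A.
  have [r0 px _ pA] := pP A Ax; apply: pA.
  have [_ p0x _ _] := pP A0 SA0.2.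
  apply: ball_triangle px _; apply: ball_sym; apply: le_ball p0x.
  by apply: A0min.
- move=> x Cx; pose c : C := exist _ x (mem_set Cx).
  have [A GA Afc] : (\bigcup_(A in G) A) (f c) by rewrite GT.
  have G'A : G' A by split=> //; exists (f c); split=> //; exists c.
  exists (e A); first by exists A.
  split; last by have [_ WA] := WP A G'A; exact: (WA c).
  have : nbhs c (f @^-1` A) by apply: open_nbhs_nbhs; split=> //; exact/preo/Go.
  move=> /nbhs_set_type[O [oO Oc] OA].
  have /nbhs_ballP[r /= r0 rO] : nbhs x O by exact: open_nbhs_nbhs.
  exists (c, r / 2)%R; split=> /=.
  - by rewrite divr_gt0.
  - by apply: ballxx; rewrite divr_gt0.
  - by [].
  - by move=> d; rewrite -splitr => cd; apply/OA/rO.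
Qed.

(** * Contradiction with the dimension of [X] *)

Theorem mainTheorem3 (R : realType) (n : nat) (X : metricType R) :
  is_space X ->
  strongly_locally_homogeneous X ->
  is_continuum X ->
  dim_eq X (Posz n) ->
  V_continuum n X.
Proof.
move=> _ slh [Xc Xconn] [_ dimX] P Q cP cQ PQ0 [p Pp] [q Qq].
have hX : hausdorff_space X by exact: metric_hausdorff.
have nX : normal_space X by exact: compact_normal.
have T1 : accessible_space X by exact: hausdorff_accessible.
apply: contrapT => nV.
(* A target of dimension at most n - 2 gives multiplicity n - 1; for n = 0 no such target exists, as
   [dim_le] fails below -1. *)
have {nV} PQ w : open_cover w -> n <> 0%N /\
    exists2 C, thin n.-1 w C & partition_between P Q C.
  move=> wc; apply: contrapT => nthin; apply: nV; exists w => // C PQC.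
  move=> [Y [f [_ dimY fw]]]; have n0 : n <> 0%N.
    by move=> n0; case: dimY => + _; rewrite n0.
  apply: nthin; split=> //; exists C => //.
  have Cc : compact C by apply: subclosed_compact Xc _ => //; case: PQC.
  apply: (omega_map_thin Cc wc fw dimY).
  case: (n) n0 => // m _.
  by rewrite -addrA (_ : - 2%:Z + 1 = - 1)%R// -[in Posz _]addn1 PoszD addrK.
case: n => [|[|m]] in dimX PQ *.
- by have [] := PQ _ (open_cover_setT X).
(* For n = 1 the partition is empty, so [U] is the complement of [V], hence open and closed, against
   connectedness. *)
- have [_ [C /thin0_eq0 -> [_ [U [V [oU oV UV CE [PU QV]]]]]]] :=
    PQ _ (open_cover_setT X).
  rewrite setC0 in CE.
  have : (set0 : set X) q; last by [].
  rewrite -UV; split; last by apply: QV; exact: nbhs_singleton.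
  suff -> : U = setT by [].
  apply: Xconn; first by exists p; apply: PU; exact: nbhs_singleton.
    by exists U; rewrite ?setTI.
  exists (~` V); rewrite ?setTI; first exact: open_closedC.
  apply/seteqP; split=> x.
    by move=> Ux Vx; have : (U `&` V) x by []; rewrite UV.
  by move=> nVx; have : (U `|` V) x by [rewrite -CE]; case.
have pq : locally_thin_separable m.+1 p q.
  by exists P, Q; split=> // w /PQ[].
have pall := locally_thin_separable_allr T1 slh Xconn pq.
(* Separation spreads from the base point [p] to all points, then by symmetry to every base point
   [x]. *)
have allsep (x y : X) : y <> x -> locally_thin_separable m.+1 x y.
  have [->|/eqP xp] := eqVneq x p; first exact: pall.
  apply: locally_thin_separable_allr T1 slh Xconn _ y.
  by apply: locally_thin_separableC; exact: pall.
apply: dimX; split=> // F Ff Fc.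
(* With n = m + 2, refinements of multiplicity m + 2 mean dimension at most n - 1, against
   [dimX]. *)
rewrite subrK; apply: (@refinement_of_thin_separable X m.+1) => // x A.
by apply: thin_separable_point_closed => // y; apply: allsep.
Qed.
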